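(* Consider the impulsive Lasota-Wazewska model $$N'(t)+a(t)N(t)=\sum_{i=1}^n b_i(t)e^{-\beta_i(t)N(t-\tau_i(t))}\quad(0\le t\ne t_k),\qquad \Delta N(t_k):=N(t_k^+)-N(t_k)=I_k(N(t_k))\quad(k=1,2,\dots),\tag{L}$$ in the setting described in the context. Assume that there exist constants $a_1,\dots,a_p$ and $b_1,\dots,b_p$ with $b_k>-1$ such that $$b_k\le\frac{I_k(x)-I_k(y)}{x-y}\le a_k,\qquad x,y\ge0,\ x\ne y,\ k=1,\dots,p,$$ and that $\prod_{k=1}^p(1+a_k)\le1$. Assume also that there is a positive $\omega$-periodic solution $N^*(t)$ of (L). Then $N^*(t)$ is globally attractive if $$\sum_{i=1}^n\beta_i(t)b_i(t)\max_{\theta\in[-\tau_i(t),0]}\ \prod_{k:\,t_k\in[t+\theta,t)}(1+b_k)^{-1}\le a(t),\qquad t\ge0.$$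
   Context: Setting. $\omega>0$ and $n,p$ are positive integers. The functions $a,b_i,\beta_i,\tau_i:\mathbb{R}\to(0,\infty)$, $1\le i\le n$, are continuous, positive and $\omega$-periodic; $\bar\tau=\max_{1\le i\le n}\max_t\tau_i(t)$; each map $t\mapsto t-\tau_i(t)$ may be assumed non-decreasing. $0<t_1<t_2<\cdots$, $t_k\to\infty$; $I_k:[0,\infty)\to\mathbb{R}$ are continuous with $u+I_k(u)>0$ for $u>0$; $t_{k+p}=t_k+\omega$ and $I_{k+p}(u)=I_k(u)$ for $k\in\mathbb{N}$, $u>0$; exactly $p$ impulse instants $t_1,\dots,t_p$ lie in $[0,\omega]$. The constants are extended by $a_{k+p}=a_k$, $b_{k+p}=b_k$. An empty product equals 1. Solutions are left continuous and $N'(t)$ is the left-hand derivative. Positive solutions of (L) are the solutions with initial condition $N(\theta)=\phi(\theta)$ on $[-\bar\tau,0]$, where $\phi:[-\bar\tau,0]\to[0,\infty)$ is continuous with $\phi(0)>0$. $N^*$ is globally attractive means that every positive solution $N$ of (L) satisfies $\lim_{t\to\infty}(N(t)-N^*(t))=0$. *)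

(* Defs.v *)
From HB Require Import structures.
From mathcomp Require Import all_boot all_order all_algebra.
From mathcomp Require Import all_classical all_reals all_analysis.

Set Implicit Arguments.
Unset Strict Implicit.
Unset Printing Implicit Defensive.

Import Order.TTheory GRing.Theory Num.Theory.
Import numFieldNormedType.Exports.

Local Open Scope classical_set_scope.
Local Open Scope ring_scope.

(* Sequences attached to the impulses (instants, jump maps, constants) are
   indexed from 0: index k stands for the (k+1)-st impulse. *)

Definition has_left_derivative (R : realType) (f : R -> R) (x l : R) : Prop :=
  h^-1 * (f (x + h) - f x) @[h --> 0^'-] --> l.

(* The delays are positive, continuous and periodic, so that each [sup] is
   attained and the default value 0 is harmless: this is the maximal delay. *)
Definition max_delay (R : realType) (n : nat) (tau : 'I_n -> R -> R) : R :=
  \big[Num.max/0]_(i < n) sup (range (tau i)).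

(* Only the values of N on [- max_delay tau, +oo[ matter. Nothing is asked
   here of N before time 0. The differential equation is asked at s > 0, since
   the left-hand derivative at 0 would only involve the initial function. The
   last clause says that N (t_k^+) exists and N (t_k^+) - N (t_k) =
   I_k (N (t_k)). *)
Definition is_solution (R : realType) (n : nat)
    (a : R -> R) (b beta tau : 'I_n -> R -> R)
    (t : nat -> R) (I : nat -> R -> R) (N : R -> R) : Prop :=
  [/\ forall s, 0 < s -> N x @[x --> s^'-] --> N s,
      forall s, 0 <= s -> (forall k, s <> t k) -> N x @[x --> s^'+] --> N s,
      forall s, 0 < s -> (forall k, s <> t k) ->
        exists2 dN : R, has_left_derivative N s dN &
          dN + a s * N s =
          \sum_(i < n) b i s * expR (- (beta i s * N (s - tau i s))) &
      forall k, N x @[x --> (t k)^'+] --> N (t k) + I k (N (t k))].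

(* The initial function is the restriction of N to [- max_delay tau, 0]. *)
Definition is_positive_solution (R : realType) (n : nat)
    (a : R -> R) (b beta tau : 'I_n -> R -> R)
    (t : nat -> R) (I : nat -> R -> R) (N : R -> R) : Prop :=
  [/\ {within `[- max_delay tau, 0], continuous N},
      forall theta, theta \in `[- max_delay tau, 0] -> 0 <= N theta,
      0 < N 0 &
      is_solution a b beta tau t I N].

(* Periodicity is asked on [0, +oo[ only: this covers both a periodic function
   on the whole line (whose initial segment may have jumps) and a solution with
   a continuous initial function that is periodic from time 0 on. *)
Definition is_positive_periodic_solution (R : realType) (n : nat) (omega : R)
    (a : R -> R) (b beta tau : 'I_n -> R -> R)
    (t : nat -> R) (I : nat -> R -> R) (N : R -> R) : Prop :=
  [/\ is_solution a b beta tau t I N,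
      forall s, 0 <= s -> 0 < N s &
      forall s, 0 <= s -> N (s + omega) = N s].

Definition globally_attractive (R : realType) (n : nat)
    (a : R -> R) (b beta tau : 'I_n -> R -> R)
    (t : nat -> R) (I : nat -> R -> R) (Nstar : R -> R) : Prop :=
  forall N : R -> R, is_positive_solution a b beta tau t I N ->
    N s - Nstar s @[s --> +oo] --> (0 : R).

Definition impulse_prod (R : realType) (t : nat -> R) (bI : nat -> R)
    (x y : R) : R :=
  \big[*%R/1]_(k \in [set k | t k \in `[x, y[]) (1 + bI k)^-1.

(* Finitely many instants lie in [s - d, s[, so that the products take finitely
   many values and the [sup] is a maximum. *)
Definition max_impulse_prod (R : realType) (t : nat -> R) (bI : nat -> R)
    (d s : R) : R :=
  sup [set impulse_prod t bI (s + theta) s | theta in `[- d, 0]].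

(* Main.v *)
Require Import Defs.
From HB Require Import structures.
From mathcomp Require Import all_boot all_order all_algebra.
From mathcomp Require Import all_classical all_reals all_analysis.
From mathcomp Require Import zify ring lra.

Set Implicit Arguments.
Unset Strict Implicit.
Unset Printing Implicit Defensive.

Import Order.TTheory GRing.Theory Num.Theory.
Import numFieldNormedType.Exports.

Local Open Scope classical_set_scope.
Local Open Scope ring_scope.

(** Let [u] be the difference of a positive solution [N] and the periodic
    solution [Nstar]. An impulse multiplies [u (t k)] by a ratio [r k] with
    [0 < 1 + bI k <= r k <= 1 + aI k]. Dividing [u s] by the product [Q s] of
    the ratios of all impulses before [s] gives a function [y] without jumps.
    The factor with which a delayed value of [y] enters the equation for [y] is
    [Q (s - tau i s) / Q s], a product of inverse ratios over [s - tau i s, s[,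
    hence at most the maximal impulse product of the hypothesis. So in the
    linear delay inequality that [|y|] satisfies, the delayed terms have total
    weight at most [a s], the weight of the damping term.

    Equality of the weights would only give boundedness. The strict gain comes
    from the exponential nonlinearity: [Nstar] stays above some [Nmin > 0], so
    [z |-> exp (- z)] contracts distances between [beta * N] and [beta * Nstar]
    by a factor [kappa < 1] that does not depend on time
    ([expR_contraction]). Hence the delayed terms weigh at most [kappa * a s],
    and a Halanay-type argument gives [|y s| < K * exp (- lam * s)]
    ([difference_quotient_decay]). Finally [Q] is bounded since the product of
    [1 + aI k] over a period is at most 1 ([periodic_prod_bounded]), so [u]
    tends to 0.

    Both the lower bound for solutions ([positive_lower_bound]) and the decay
    of [y] are barrier arguments: at the first time where the function meets
    its exponential barrier, the left derivatives of the two are ordered, and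
    the differential equation contradicts that order ([first_crossing],
    [left_derivative_le]). The equation is not available at the impulse
    instants; as these are countably many, the height of the barrier can be
    chosen so that no contact takes place there ([avoid_sequence]). *)

(** * Barriers and left derivatives *)

(** The infimum [z] of the set where [g <= 0] satisfies [g z <= 0], because
    positivity at [z] would spread to the right, and [g z >= 0] by left
    continuity: it is a point of contact. The hypothesis on the right side of
    [s] is weaker than continuity, so that [g] may have jumps as long as they
    do not destroy positivity. *)
Lemma first_crossing (R : realType) (g : R -> R) (T0 : R)
    (g0 : 0 < g T0)
    (g_left : forall s, T0 < s -> g x @[x --> s^'-] --> g s)
    (g_right : forall s, T0 <= s -> 0 < g s -> \forall x \near s^'+, 0 < g x)
    (no_touch : forall s, T0 < s -> (forall x, T0 <= x < s -> 0 < g x) ->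
       g s <> 0) :
  forall s, T0 <= s -> 0 < g s.
Proof.
move=> s T0s; rewrite ltNge; apply/negP => gs0.
pose S := [set x | T0 <= x /\ g x <= 0].
have SN0 : S !=set0 by exists s.
have S_lb : has_lbound S by exists T0 => x [].
have S_inf : has_inf S by split.
set z := inf S.
have T0z : T0 <= z by apply: lb_le_inf => // x [].
have before x : T0 <= x < z -> 0 < g x.
  move=> /andP[T0x xz]; rewrite ltNge; apply/negP => gx.
  by have := ge_inf S_lb (conj T0x gx); rewrite leNgt xz.
have gz0 : g z <= 0.
  rewrite leNgt; apply/negP => gz.
  have /(not_near_at_rightP z (fun x => 0 < g x)) : forall e : {posnum R},
    exists2 x, z < x < z + e%:num & ~ 0 < g x; last first.
    by apply; exact: g_right.
  move=> e.
  have [x [T0x gx] xz] := inf_adherent [gt0 of e%:num] S_inf.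
  exists x; last by apply/negP; rewrite -leNgt.
  rewrite xz andbT lt_neqAle (ge_inf S_lb) ?andbT//.
  by apply: contraTneq gz => ->; rewrite -leNgt.
have T0z' : T0 < z.
  rewrite lt_neqAle T0z andbT.
  by apply: contraTneq gz0 => <-; rewrite -ltNge.
apply: (no_touch z T0z' before); apply/eqP; rewrite eq_le gz0 /=.
apply: (cvgr_to_ge (g_left _ T0z')).
near=> x; apply/ltW/before; apply/andP; split.
  by near: x; exact: nbhs_left_ge.
by near: x; exact: nbhs_left_lt.
Unshelve. all: by end_near. Qed.

(** For negative increments [h] the factor [h^-1] reverses the inequality
    between [f] and [g]. *)
Lemma left_derivative_le (R : realType) (f g : R -> R) (s l m : R)
    (fl : has_left_derivative f s l) (gm : has_left_derivative g s m)
    (fg : \forall x \near s^'-, f x <= g x) (fgs : f s = g s) :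
  m <= l.
Proof.
apply: (ler_cvg_to gm fl).
have : \forall h \near 0^'-, f (s + h) <= g (s + h).
  have [e /= e0 H] : nbhs s^'- [set x | f x <= g x] by [].
  exists e => //= h he h0; apply: H => /=; last by rewrite gtrDl.
  by move: he; rewrite /= sub0r opprD addNKr.
move=> H; near=> h.
have h0 : h < 0 by near: h; exact: nbhs_left_lt.
rewrite ler_nM2l ?invr_lt0// fgs lerD2r.
by near: h.
Unshelve. all: by end_near. Qed.

Lemma has_left_derivativeB (R : realType) (f g : R -> R) (s l m : R) :
  has_left_derivative f s l -> has_left_derivative g s m ->
  has_left_derivative (fun x => f x - g x) s (l - m).
Proof.
move=> fl gm; apply: cvg_trans (cvgB fl gm); apply: near_eq_cvg; near=> h.
rewrite /= ?fctE; ring.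
Unshelve. all: by end_near. Qed.

Lemma has_left_derivativeZ (R : realType) (f : R -> R) (s l c : R) :
  has_left_derivative f s l -> has_left_derivative (fun x => c * f x) s (c * l).
Proof.
move=> fl; apply: cvg_trans (cvgM (cvg_cst c) fl); apply: near_eq_cvg; near=> h.
rewrite /= ?fctE; ring.
Unshelve. all: by end_near. Qed.

Lemma has_left_derivative_exp (R : realType) (c r s : R) :
  has_left_derivative (fun x => c * expR (- (r * x))) s
    (- (r * (c * expR (- (r * s))))).
Proof.
have D : is_derive s 1 (fun x => c * expR (- (r * x)))
    (- (r * (c * expR (- (r * s))))).
  apply: is_derive_eq; rewrite /GRing.scale /=; ring.
have [/cvg_ex[l cl] El] := D.
have <- : l = - (r * (c * expR (- (r * s)))).
  by rewrite -El; apply/esym; exact: (cvg_lim _ cl).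
apply: cvg_trans (cvg_dnbhs_at_left cl); apply: near_eq_cvg; near=> h.
by rewrite /GRing.scale /= mulr1 [h + s]addrC.
Unshelve. all: by end_near. Qed.

(** A sequence has a countable range, which is negligible for the Lebesgue
    measure, unlike an interval. *)
Lemma avoid_sequence (R : realType) (v : nat -> R) (x y : R) :
  x < y -> exists2 z, x < z < y & forall k, v k <> z.
Proof.
move=> xy; apply: contrapT => H.
have sub : `]x, y[%classic `<=` range v.
  move=> z /= zxy; apply: contrapT => Nz; apply: H; exists z.
    by move: zxy; rewrite in_itv.
  by move=> k vk; apply: Nz; exists k.
have c : countable (`]x, y[%classic : set R).
  by apply: sub_countable (subset_card_le sub) _; exact: card_image_le.
have := countable_lebesgue_measure0 c.
rewrite lebesgue_measure_itv /= lte_fin xy -EFinD => -[] /eqP.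
by rewrite subr_eq0 gt_eqF.
Qed.

(** * The contraction factor of the nonlinearity *)

(** Cut [x, y] at its midpoint and bound the decrement of [exp (- z)] on each
    half by the slope at the left end of that half: at most 1 on the first half
    and, as the midpoint is at least [q / 2], at most [exp (- (q / 2))] on the
    second. *)
Lemma expR_decrement_le (R : realType) (q x y : R) :
  0 <= x -> x <= y -> q <= x + y ->
  expR (- x) - expR (- y) <= (1 + expR (- (q / 2))) / 2 * (y - x).
Proof.
have step (u w : R) : u <= w -> expR (- u) - expR (- w) <= expR (- u) * (w - u).
  move=> uw; have := expR_ge1Dx (- (w - u)).
  rewrite -(ler_pM2l (expR_gt0 (- u))) -expRD => H.
  have E : - u - (w - u) = - w by ring.
  by move: H; rewrite E mulrDr mulr1 mulrN; lra.
move=> x0 xy qxy; pose w := (x + y) / 2.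
have xw : x <= w by rewrite /w; lra.
have wy : w <= y by rewrite /w; lra.
have H1 := step _ _ xw; have H2 := step _ _ wy.
have e1 : expR (- x) <= 1 by rewrite -[leRHS]expR0 ler_expR oppr_le0.
have e2 : expR (- w) <= expR (- (q / 2)) by rewrite ler_expR /w; lra.
have H3 : expR (- x) * (w - x) <= 1 * (w - x) by apply: ler_wpM2r; lra.
have H4 : expR (- w) * (y - w) <= expR (- (q / 2)) * (y - w).
  by apply: ler_wpM2r; lra.
have -> : (1 + expR (- (q / 2))) / 2 * (y - x)
  = 1 * (w - x) + expR (- (q / 2)) * (y - w) by rewrite /w; field.
lra.
Qed.

Lemma expR_contraction (R : realType) (q x y : R) :
  0 <= x -> 0 <= y -> q <= y ->
  `|expR (- x) - expR (- y)| <= (1 + expR (- (q / 2))) / 2 * `|x - y|.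
Proof.
move=> x0 y0 qy; have [xy|/ltW yx] := leP x y.
  rewrite ger0_norm ?subr_ge0 ?ler_expR ?lerN2// distrC ger0_norm ?subr_ge0//.
  by apply: expR_decrement_le => //; lra.
rewrite distrC !ger0_norm ?subr_ge0 ?ler_expR ?lerN2//.
by apply: expR_decrement_le => //; lra.
Qed.

(** * Periodic data *)
Lemma nat_period_ind (P : nat -> Prop) (p : nat) : (0 < p)%N ->
  (forall k, (k < p)%N -> P k) -> (forall k, P k -> P (k + p)%N) ->
  forall k, P k.
Proof.
move=> p0 base step; elim/ltn_ind => k IH.
have [/base//|pk] := ltnP k p.
by rewrite -(subnK pk); apply/step/IH; lia.
Qed.

Lemma le_sum_term (R : realType) (F : nat -> R) (M j : nat) :
  (forall k, 0 <= F k) -> (j < M)%N -> F j <= \sum_(k < M) F k.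
Proof.
move=> F0 jM; rewrite (bigD1 (Ordinal jM)) //= lerDl.
by apply: sumr_ge0.
Qed.

Lemma finite_lower_bound (R : realType) (J : finType) (F : J -> R) :
  (forall j, 0 < F j) -> exists c, [/\ 0 < c, c <= 1 & forall j, c <= F j].
Proof.
move=> F0; exists (\big[Order.min/1]_j F j); split.
- by apply: lt_bigmin => // j _; rewrite F0.
- exact: bigmin_le_id.
- by move=> j; exact: bigmin_le_cond.
Qed.

(** Adding a full period to the range of the product multiplies it by a number
    at most 1, so the first [p] partial products dominate the others. *)
Lemma periodic_prod_bounded (R : realType) (A : nat -> R) (p : nat) :
  (0 < p)%N -> (forall k, A (k + p)%N = A k) -> (forall k, 0 < A k) ->
  \prod_(k < p) A k <= 1 ->
  exists2 C, 0 < C & forall m, \prod_(k < m) A k <= C.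
Proof.
move=> p0 Aper A0 Ap1.
have P0 m : 0 < \prod_(k < m) A k by apply: prodr_gt0.
exists (\sum_(m < p) \prod_(k < m) A k).
  apply: lt_le_trans (P0 0%N) _.
  by apply: (le_sum_term (F := fun m => \prod_(k < m) A k)) => // k; apply/ltW.
apply: (nat_period_ind p0) => [m mp|m IH].
  by apply: (le_sum_term (F := fun m => \prod_(k < m) A k)) => // k; apply/ltW.
apply: le_trans IH.
rewrite addnC big_split_ord /=.
under [X in _ * X]eq_bigr do rewrite addnC Aper.
by rewrite ler_piMl //; exact: ltW (P0 m).
Qed.

Lemma periodic_reduction (R : realType) (omega : R) (f : R -> R) :
  0 < omega -> (forall s, 0 <= s -> f (s + omega) = f s) ->
  forall s, 0 <= s -> exists2 r, 0 <= r <= omega & f s = f r.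
Proof.
move=> w0 fper s s0.
have [n sn] : exists n : nat, s <= n%:R * omega.
  exists (Num.bound (s / omega)); rewrite -ler_pdivrMr//.
  by apply/ltW/archi_boundP; rewrite divr_ge0// ltW.
elim: n s s0 sn => [|n IH] s s0 sn.
  by exists s => //; rewrite s0; move: sn; rewrite mul0r; lra.
have [sw|/ltW ws] := leP s omega; first by exists s; rewrite ?s0.
have [||r r0w fr] := IH (s - omega); first by lra.
  by move: sn; rewrite -natr1 mulrDl mul1r; lra.
by exists r => //; rewrite -fr -(fper (s - omega)) ?subrK//; lra.
Qed.

(** The two bounds are packed into one pair, so that the axiom of choice turns a
    family of such statements into a function giving both bounds. *)
Lemma periodic_bounds (R : realType) (omega : R) (f : R -> R) :
  0 < omega -> continuous f -> (forall s, f (s + omega) = f s) ->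
  (forall s, 0 < f s) ->
  exists lohi : R * R, [/\ 0 < lohi.1, 0 < lohi.2 &
    forall s, 0 <= s -> lohi.1 <= f s <= lohi.2].
Proof.
move=> w0 fc fper f0.
have fcw : {within `[0, omega], continuous f} by exact: continuous_subspaceT.
have [x _ hx] := EVT_min (ltW w0) fcw.
have [y _ hy] := EVT_max (ltW w0) fcw.
exists (f x, f y); split => [||s s0]; rewrite ?f0 //=.
have [r r0w ->] := periodic_reduction w0 (fun s _ => fper s) s0.
by rewrite hx ?hy// in_itv.
Qed.

(** * Counting the impulses *)

(** The number [m s] of instants before [s] turns the products over the
    impulses in an interval into products over ranges of natural numbers, and
    its one-sided local constancy encodes that a step function of the impulses
    is left continuous with jumps at the instants only. *)
Lemma impulse_counter (R : realType) (t : nat -> R) :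
  (forall k, t k < t k.+1) -> t k @[k --> \oo] --> +oo ->
  exists m : R -> nat, forall s k, (t k < s) = (k < m s)%N.
Proof.
move=> tincr tinf.
have tmono : {homo t : i j / (i <= j)%N >-> i <= j}.
  by apply: homo_leq => [//|x y z|k]; [exact: le_trans|exact: ltW].
have ex s : exists k, s <= t k.
  have [K _ HK] : \forall k \near \oo, s <= t k by move/cvgryPge: tinf; exact.
  by exists K; apply: HK => /=.
exists (fun s => ex_minn (ex s)) => s k.
case: ex_minnP => j sj jmin; rewrite ltNge [RHS]ltnNge; congr (~~ _).
apply/idP/idP => [|jk]; first exact: jmin.
exact: le_trans sj (tmono _ _ jk).
Qed.

Lemma counter_le (R : realType) (t : nat -> R) (m : R -> nat)
    (mP : forall s k, (t k < s) = (k < m s)%N) (x y : R) :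
  x <= y -> (m x <= m y)%N.
Proof.
move=> xy; rewrite leqNgt; apply/negP; rewrite -mP => tx.
by have := lt_le_trans tx xy; rewrite mP ltnn.
Qed.

Lemma counter_left (R : realType) (t : nat -> R) (m : R -> nat)
    (mP : forall s k, (t k < s) = (k < m s)%N) (s : R) :
  \forall x \near s^'-, m x = m s.
Proof.
have ge_m : \forall x \near s^'-, (m s <= m x)%N.
  case E : (m s) => [|j]; first by near=> z.
  have tj : t j < s by rewrite mP E.
  by near=> z; rewrite -mP; near: z; exact: nbhs_left_gt.
near=> x.
have xs : x <= s by near: x; exact: nbhs_left_le.
apply/eqP; rewrite eqn_leq (counter_le mP xs) /=.
by near: x.
Unshelve. all: by end_near. Qed.

Lemma counter_right (R : realType) (t : nat -> R) (m : R -> nat)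
    (mP : forall s k, (t k < s) = (k < m s)%N) (s : R) :
  (forall k, s <> t k) -> \forall x \near s^'+, m x = m s.
Proof.
move=> st; have sm : s < t (m s).
  by rewrite lt_neqAle leNgt mP ltnn andbT; apply/eqP.
near=> x.
have sx : s <= x by near: x; exact: nbhs_right_ge.
apply/eqP; rewrite eqn_leq (counter_le mP sx) andbT leqNgt -mP -leNgt.
by near: x; exact: nbhs_right_le.
Unshelve. all: by end_near. Qed.

Lemma counter_impulse (R : realType) (t : nat -> R) (m : R -> nat)
    (mP : forall s k, (t k < s) = (k < m s)%N)
    (tincr : forall k, t k < t k.+1) (k : nat) :
  m (t k) = k /\ \forall x \near (t k)^'+, m x = k.+1.
Proof.
have mk : m (t k) = k.
  apply/eqP; rewrite eqn_leq leqNgt -mP ltxx /=.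
  by case: k => // k; rewrite -mP.
split=> //; near=> x; apply/eqP; rewrite eqn_leq -mP leqNgt -mP -leNgt.
apply/andP; split; near: x.
  exact: nbhs_right_le.
exact: nbhs_right_gt.
Unshelve. all: by end_near. Qed.

Lemma impulse_prodE (R : realType) (t : nat -> R) (m : R -> nat)
    (mP : forall s k, (t k < s) = (k < m s)%N) (bI : nat -> R) (x y : R) :
  impulse_prod t bI x y = \prod_(m x <= k < m y) (1 + bI k)^-1.
Proof.
rewrite /impulse_prod.
have -> : [set k | t k \in `[x, y[] = [set` index_iota (m x) (m y)].
  apply/seteqP; split => k /=;
    by rewrite in_itv /= mP mem_index_iota leNgt mP -leqNgt.
by rewrite -fsbig_seq ?iota_uniq.
Qed.

(** The supremum is over a bounded set: for given [s] the product depends only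
    on the index [j] of the first impulse in the interval, and it is at most
    the sum of its values over all possible [j]. *)
Lemma prod_le_max_impulse_prod (R : realType) (t : nat -> R) (m : R -> nat)
    (mP : forall s k, (t k < s) = (k < m s)%N) (bI : nat -> R)
    (bI_gt : forall k, -1 < bI k) (d s : R) : 0 <= d ->
  \prod_(m (s - d) <= k < m s) (1 + bI k)^-1 <= max_impulse_prod t bI d s.
Proof.
move=> d0; rewrite -(impulse_prodE mP); apply: sup_upper_bound; last first.
  by exists (- d) => //=; rewrite in_itv /= lexx oppr_le0.
split; first by exists (impulse_prod t bI (s - d) s), (- d) => //=;
  rewrite in_itv /= lexx oppr_le0.
exists (\sum_(j < (m s).+1) \prod_(j <= k < m s) (1 + bI k)^-1).
move=> _ [th /= + <-]; rewrite in_itv /= => /andP[_ th0].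
rewrite (impulse_prodE mP).
apply: (le_sum_term (F := fun j => \prod_(j <= k < m s) (1 + bI k)^-1)).
  move=> j; apply: prodr_ge0 => k _; rewrite invr_ge0.
  by have := bI_gt k; lra.
by rewrite ltnS (counter_le mP)//; lra.
Qed.

(** * A positive lower bound for solutions *)
Lemma exp_decay_continuous (R : realType) (c r : R) :
  continuous (fun x => c * expR (- (r * x))).
Proof.
move=> x; apply: cvgM; first exact: cvg_cst.
apply: (continuous_comp (f := fun x => - (r * x)) (g := expR)).
  by apply: cvgN; apply: cvgM; [exact: cvg_cst|exact: cvg_id].
exact: continuous_expR.
Qed.

(** An impulse multiplies the barrier by [e] and the solution by at least [e],
    so it cannot bring them into contact. Between impulses the barrier has the
    decay rate [A >= a s], whereas the positive right-hand side makes the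
    solution decay strictly slower than at rate [a s]. *)
Lemma positive_lower_bound (R : realType) (n : nat)
    (a : R -> R) (b beta tau : 'I_n -> R -> R)
    (t : nat -> R) (I : nat -> R -> R) (N : R -> R) (m : R -> nat) (A e : R)
    (mP : forall s k, (t k < s) = (k < m s)%N)
    (t_incr : forall k, t k < t k.+1)
    (hn : (0 < n)%N) (b_pos : forall i s, 0 < b i s)
    (a_le : forall s, 0 <= s -> a s <= A)
    (e_gt0 : 0 < e) (e_le1 : e <= 1)
    (jump : forall k u, 0 < u -> e * u <= u + I k u)
    (sol : is_solution a b beta tau t I N) (N0 : 0 < N 0) :
  exists2 c, 0 < c &
    forall s, 0 <= s -> c * e ^+ m s * expR (- (A * s)) < N s.
Proof.
have [Nl Nr Nd NI] := sol.
pose v k := N (t k) / (e ^+ k * expR (- (A * t k))).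
(* The barrier of height [c] meets [N] at the instant [t k] iff [v k = c]. *)
have [c /andP[c0 cN0] vc] := avoid_sequence v N0.
exists c => // s s0; rewrite -subr_gt0.
pose g s := N s - c * e ^+ m s * expR (- (A * s)); rewrite -/(g s).
have barrier_gt0 x j : 0 < c * e ^+ j * expR (- (A * x)).
  by rewrite !mulr_gt0 ?exprn_gt0 ?expR_gt0.
have barrier_left j x : c * e ^+ j * expR (- (A * z)) @[z --> x^'-]
    --> c * e ^+ j * expR (- (A * x)).
  exact/cvg_at_left_filter/exp_decay_continuous.
have barrier_right j x : c * e ^+ j * expR (- (A * z)) @[z --> x^'+]
    --> c * e ^+ j * expR (- (A * x)).
  exact/cvg_at_right_filter/exp_decay_continuous.
apply: (@first_crossing _ g 0) s0 => [|x x0|x x0 gx|x x0 before gx].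
- rewrite /g mulr0 oppr0 expR0 mulr1 subr_gt0 (le_lt_trans _ cN0)//.
  by rewrite ler_piMr ?exprn_ile1// ltW.
- apply: cvg_trans (cvgB (Nl _ x0) (barrier_left (m x) x)).
  apply: near_eq_cvg; near=> z; rewrite /g /=.
  suff -> : m z = m x by [].
  by near: z; exact: (counter_left mP).
- have [[k xk]|xt] := pselect (exists k, x = t k).
    rewrite xk in gx *; have [mk mk1] := counter_impulse mP t_incr k.
    have Ntk : 0 < N (t k).
      by apply: lt_trans gx _; rewrite /g gtrBl.
    have lim_gt0 : 0 < N (t k) + I k (N (t k))
        - c * e ^+ k.+1 * expR (- (A * t k)).
      rewrite subr_gt0; apply: lt_le_trans (jump k _ Ntk).
      rewrite exprS mulrCA -mulrA ltr_pM2l//.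
      by move: gx; rewrite /g mk subr_gt0.
    have := cvgr_gt _ (cvgB (NI k) (barrier_right k.+1 (t k))) _ lim_gt0.
    move=> H; near=> z; rewrite /g.
    have -> : m z = k.+1 by near: z; exact: mk1.
    by near: z; exact: H.
  have xt' k : x <> t k by move=> xk; apply: xt; exists k.
  have := cvgr_gt _ (cvgB (Nr _ x0 xt') (barrier_right (m x) x)) _ gx.
  move=> H; near=> z; rewrite /g.
  have -> : m z = m x by near: z; exact: (counter_right mP).
  by near: z; exact: H.
- have xt k : x <> t k.
    move=> xk; apply: (vc k); rewrite /v.
    have [mk _] := counter_impulse mP t_incr k.
    move: gx; rewrite /g xk mk => /eqP; rewrite subr_eq0 => /eqP ->.
    by rewrite -mulrA mulfK // gt_eqF // mulr_gt0 ?exprn_gt0 ?expR_gt0.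
  have [dN NdN eqN] := Nd x x0 xt.
  have Nx : c * e ^+ m x * expR (- (A * x)) = N x.
    by apply/esym/eqP; rewrite -subr_eq0; apply/eqP.
  have dN_le : dN <= - (A * (c * e ^+ m x * expR (- (A * x)))).
    have dE := @has_left_derivative_exp R (c * e ^+ m x) A x.
    apply: (left_derivative_le dE NdN) Nx.
    near=> z; have <- : m z = m x by near: z; exact: (counter_left mP).
    rewrite ltW// -subr_gt0; apply: before; apply/andP; split; near: z.
      exact: nbhs_left_ge.
    exact: nbhs_left_lt.
  have : 0 < dN + a x * N x.
    rewrite eqN (bigD1 (Ordinal hn)) //= ltr_pwDl ?mulr_gt0 ?expR_gt0//.
    by apply: sumr_ge0 => i _; rewrite mulr_ge0 ?expR_ge0 // ltW.
  apply/negP; rewrite -leNgt; move: dN_le; rewrite Nx => dN_le.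
  have Nx0 : 0 <= N x by rewrite -Nx; exact: ltW.
  have := ler_wpM2r Nx0 (a_le _ (ltW x0)); lra.
Unshelve. all: by end_near. Qed.

(** * Exponential decay of the difference quotient *)
Lemma decay_rate (R : realType) (alpha kappa D : R) :
  0 < alpha -> kappa < 1 ->
  exists2 lam, 0 < lam & lam < alpha * (1 - kappa * expR (lam * D)).
Proof.
move=> alpha0 kappa1.
pose h l := alpha * (1 - kappa * expR (l * D)) - l.
have ch : h l @[l --> 0] --> h 0.
  rewrite /h; apply: cvgB; last exact: cvg_id.
  apply: cvgM; first exact: cvg_cst.
  apply: cvgB; first exact: cvg_cst.
  apply: cvgM; first exact: cvg_cst.
  apply: continuous_cvg; first exact: continuous_expR.
  by apply: cvgM; [exact: cvg_id|exact: cvg_cst].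
have h0 : 0 < h 0.
  by rewrite /h mul0r expR0 mulr1 subr0 mulr_gt0// subr_gt0.
have near_h : \forall l \near 0^'+, 0 < h l.
  exact: cvgr_gt _ (cvg_at_right_filter ch) _ h0.
have [l [l0 hl]] := filter_ex (filterI (nbhs_right_gt 0) near_h).
by exists l => //; rewrite -subr_gt0.
Qed.

(** With [Q s] the product of the ratios before [s], this bounds the weight
    [Q (s - d) / Q s] of a delayed value. *)
Lemma ratio_prod_delay (R : realType) (t bI r : nat -> R) (m : R -> nat)
    (mP : forall s k, (t k < s) = (k < m s)%N)
    (bI_gt : forall k, -1 < bI k) (r_ge : forall k, 1 + bI k <= r k)
    (d s : R) : 0 <= d ->
  \prod_(k < m (s - d)) r k
    <= max_impulse_prod t bI d s * \prod_(k < m s) r k.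
Proof.
move=> d0; have b0 k : 0 < 1 + bI k by have := bI_gt k; lra.
have r0 k : 0 < r k by apply: lt_le_trans (r_ge k).
have mle : (m (s - d)%R <= m s)%N by apply: (counter_le mP); lra.
have -> : \prod_(k < m (s - d)) r k
    = \prod_(m (s - d) <= k < m s) (r k)^-1 * \prod_(k < m s) r k.
  rewrite -!(big_mkord xpredT) (big_cat_nat (leq0n _) mle) /=.
  rewrite mulrCA -big_split /=.
  rewrite [X in _ * X]big1 ?mulr1 // => k _.
  by rewrite mulVf // gt_eqF.
apply: ler_wpM2r; first by apply: prodr_ge0 => k _; exact: ltW.
apply: le_trans (prod_le_max_impulse_prod mP bI_gt s d0).
apply: ler_prod => k _; rewrite invr_ge0 (ltW (r0 k)) /=.
by rewrite lef_pV2 ?posrE.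
Qed.

(** Up to the time [D] the quotient [y] is bounded by compactness, which fixes
    the height of the barrier [K * exp (- lam * s)]. From [D] on, delayed times
    are nonnegative. At a first contact all delayed values of [|y|] are below
    the barrier, hence below [exp (lam * D)] times its present value, and
    [lam_lt] says that damping then dominates. *)
Lemma difference_quotient_decay (R : realType) (n : nat)
    (a : R -> R) (b beta tau : 'I_n -> R -> R)
    (t : nat -> R) (I : nat -> R -> R) (bI r : nat -> R)
    (N Ns : R -> R) (m : R -> nat) (D kappa lam : R)
    (mP : forall s k, (t k < s) = (k < m s)%N)
    (t_incr : forall k, t k < t k.+1)
    (b_pos : forall i s, 0 < b i s) (beta_pos : forall i s, 0 < beta i s)
    (tau_pos : forall i s, 0 < tau i s)
    (D_gt0 : 0 < D) (tau_le : forall i s, 0 <= s -> tau i s <= D)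
    (bI_gt : forall k, -1 < bI k) (r_ge : forall k, 1 + bI k <= r k)
    (rE : forall k, N (t k) + I k (N (t k)) - (Ns (t k) + I k (Ns (t k)))
                    = r k * (N (t k) - Ns (t k)))
    (solN : is_solution a b beta tau t I N)
    (solNs : is_solution a b beta tau t I Ns)
    (kappa_ge0 : 0 <= kappa)
    (lip : forall i s w, 0 <= s -> 0 <= w ->
       `|expR (- (beta i s * N w)) - expR (- (beta i s * Ns w))|
         <= kappa * (beta i s * `|N w - Ns w|))
    (main_ineq : forall s, 0 <= s ->
       \sum_(i < n) beta i s * b i s * max_impulse_prod t bI (tau i s) s
         <= a s)
    (lam_gt0 : 0 < lam)
    (lam_lt : forall s, 0 <= s -> lam < a s * (1 - kappa * expR (lam * D))) :
  exists K, forall s, D <= s ->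
    `|N s - Ns s| < K * expR (- (lam * s)) * \prod_(k < m s) r k.
Proof.
have [Nl Nr Nd NI] := solN; have [Nsl Nsr Nsd NsI] := solNs.
have r0 k : 0 < r k.
  by apply: lt_le_trans (r_ge k); have := bI_gt k; lra.
pose Q j := \prod_(k < j) r k.
have Q0 j : 0 < Q j by apply: prodr_gt0.
pose y s := (N s - Ns s) / Q (m s).
have yE s : `|N s - Ns s| = `|y s| * Q (m s).
  by rewrite /y normrM normfV (gtr0_norm (Q0 _)) mulfVK // gt_eqF.
have y_left s : 0 < s -> y x @[x --> s^'-] --> y s.
  move=> s0.
  apply: cvg_trans (cvgM (cvgB (Nl s s0) (Nsl s s0)) (cvg_cst (Q (m s))^-1)).
  apply: near_eq_cvg; near=> x; rewrite /y /=.
  suff -> : m x = m s by [].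
  by near: x; exact: (counter_left mP).
have y_right s : 0 <= s -> y x @[x --> s^'+] --> y s.
  move=> s0; have [[k sk]|st] := pselect (exists k, s = t k).
    rewrite sk; have [mk mk1] := counter_impulse mP t_incr k.
    have -> : y (t k) = (N (t k) + I k (N (t k))
        - (Ns (t k) + I k (Ns (t k)))) / Q k.+1.
      rewrite rE /y mk /Q big_ord_recr /= -/(Q k).
      by field; rewrite !gt_eqF.
    apply: cvg_trans (cvgM (cvgB (NI k) (NsI k)) (cvg_cst (Q k.+1)^-1)).
    apply: near_eq_cvg; near=> x; rewrite /y /=.
    suff -> : m x = k.+1 by [].
    by near: x; exact: mk1.
  have st' k : s <> t k by move=> sk; apply: st; exists k.
  apply: cvg_trans
    (cvgM (cvgB (Nr s s0 st') (Nsr s s0 st')) (cvg_cst (Q (m s))^-1)).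
  apply: near_eq_cvg; near=> x; rewrite /y /=.
  suff -> : m x = m s by [].
  by near: x; exact: (counter_right mP).
(* [y] is continuous, since the impulse at [t k] multiplies both the difference
   and [Q] by [r k]. *)
have [K1 hK1] : exists K1, forall s, 0 <= s <= D -> `|y s| <= K1.
  have cy : {within `[0, D], continuous (fun s => `|y s|)}.
    apply/(continuous_within_itvP _ D_gt0); split.
    - move=> x; rewrite in_itv /= => /andP[x0 _].
      have yx : y z @[z --> x] --> y x.
        apply/left_right_continuousP.
        by split; [exact: y_left|exact/y_right/ltW].
      exact: cvg_norm yx.
    - exact: cvg_norm (y_right 0 (lexx 0)).
    - exact: cvg_norm (y_left D D_gt0).
  have [c _ hc] := EVT_max (ltW D_gt0) cy.
  by exists `|y c| => s s0D; apply: hc; rewrite in_itv.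
have K1_ge0 : 0 <= K1.
  by apply: le_trans (hK1 0 _); rewrite ?normr_ge0 // lexx ltW.
have K1_lt : K1 * expR (lam * D) < K1 * expR (lam * D) + 1 by rewrite ltrDl.
(* [K > K1 * exp (lam * D)] puts the barrier above [y] on all of [0, D]; the
   upper bound for [K] only provides an interval to choose from. *)
have [K /andP[K1K _] K_avoid] :=
  avoid_sequence (fun k => `|y (t k)| * expR (lam * t k)) K1_lt.
have K0 : 0 < K by apply: le_lt_trans K1K; rewrite mulr_ge0 ?expR_ge0.
exists K => s Ds; rewrite yE ltr_pM2r // -subr_gt0.
pose g s := K * expR (- (lam * s)) - `|y s|; rewrite -/(g s).
have gD x : 0 <= x <= D -> 0 < g x.
  move=> /andP[x0 xD]; rewrite subr_gt0 (le_lt_trans (hK1 x _)) ?x0 //.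
  rewrite -[ltLHS]mulr1 -ltr_pdivrMr ?expR_gt0 // -expRN opprK mulr1.
  apply: le_lt_trans K1K; apply: ler_wpM2l => //.
  by rewrite ler_expR ler_wpM2l // ltW.
have barrier := @exp_decay_continuous R K lam.
apply: (@first_crossing _ g D) s Ds => [|s Ds|s Ds gs|s Ds before gs].
- by apply: gD; rewrite lexx ltW.
- have ys := y_left s (lt_trans D_gt0 Ds).
  exact: cvgB (cvg_at_left_filter (barrier s)) (cvg_norm ys).
- have ys := y_right s (le_trans (ltW D_gt0) Ds).
  apply: (cvgr_gt (g s) _ _ gs).
  exact: cvgB (cvg_at_right_filter (barrier s)) (cvg_norm ys).
have s0 : 0 < s by exact: lt_trans Ds.
have ys : `|y s| = K * expR (- (lam * s)).
  by apply/esym/eqP; rewrite -subr_eq0; apply/eqP.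
have st k : s <> t k.
  move=> sk; apply: (K_avoid k); rewrite -sk ys -mulrA -expRD addNr expR0.
  by rewrite mulr1.
have y_lt x : 0 <= x < s -> `|y x| < K * expR (- (lam * x)).
  move=> /andP[x0 xs]; rewrite -subr_gt0 -/(g x).
  have [xD|/ltW Dx] := leP x D; first by apply: gD; rewrite x0.
  by apply: before; rewrite Dx.
have [dN NdN eqN] := Nd s s0 st; have [dNs NsdNs eqNs] := Nsd s s0 st.
(* Multiplying by the sign of [y s] replaces [|y|], which need not have a left
   derivative, by a function below it that agrees with it at [s]. *)
pose sg := Num.sg (y s).
have sgE : sg * (N s - Ns s) = `|N s - Ns s|.
  by rewrite yE normrEsg -/sg -mulrA /y mulfVK // gt_eqF.
have sg_le x : sg * x <= `|x|.
  apply: le_trans (ler_norm _) _; rewrite normrM normr_sg.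
  by rewrite ler_piMl // lern1 leq_b1.
pose E := K * Q (m s) * expR (- (lam * s)).
have E0 : 0 < E by rewrite !mulr_gt0 ?expR_gt0.
have uE : `|N s - Ns s| = E by rewrite yE ys /E; ring.
have slope : - (lam * E) <= sg * (dN - dNs).
  have du := has_left_derivativeZ (c := sg) (has_left_derivativeB NdN NsdNs).
  have dE := @has_left_derivative_exp R (K * Q (m s)) lam s.
  apply: (left_derivative_le du dE); last by rewrite sgE uE.
  near=> x; apply: le_trans (sg_le _) _; rewrite yE.
  have -> : m x = m s by near: x; exact: (counter_left mP).
  rewrite -mulrA [Q _ * _]mulrC mulrA ler_wpM2r ?ltW // y_lt //.
  apply/andP; split; near: x; first exact: nbhs_left_ge.
  exact: nbhs_left_lt.
have forcing : sg * (\sum_(i < n) b i s * expR (- (beta i s * N (s - tau i s)))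
      - \sum_(i < n) b i s * expR (- (beta i s * Ns (s - tau i s))))
    <= kappa * expR (lam * D) * E * a s.
  apply: le_trans (sg_le _) _; rewrite -sumrB.
  apply: le_trans (ler_norm_sum _ _ _) _.
  have E'0 : 0 <= kappa * expR (lam * D) * E.
    by rewrite !mulr_ge0 ?expR_ge0 // ltW.
  apply: le_trans (ler_wpM2l E'0 (main_ineq s (ltW s0))).
  rewrite mulr_sumr; apply: ler_sum => i _.
  have tau0 := tau_pos i s; have tauD := tau_le i s (ltW s0).
  have w0 : 0 <= s - tau i s by rewrite subr_ge0 (le_trans tauD) // ltW.
  rewrite -mulrBr normrM (gtr0_norm (b_pos i s)).
  have u_le : `|N (s - tau i s) - Ns (s - tau i s)|
      <= expR (lam * D) * E * max_impulse_prod t bI (tau i s) s.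
    rewrite yE; have w_lt : `|y (s - tau i s)| <= K * expR (- (lam * (s - D))).
      apply: le_trans (ltW (y_lt _ _)) _; first by rewrite w0 gtrBl.
      rewrite ler_wpM2l ?(ltW K0) // ler_expR lerN2 ler_wpM2l ?(ltW lam_gt0) //.
      by rewrite lerB.
    apply: le_trans (ler_pM _ _ w_lt
      (ratio_prod_delay mP bI_gt r_ge s (ltW tau0))) _ => //.
      exact: ltW (Q0 _).
    have -> : - (lam * (s - D)) = lam * D + - (lam * s) by ring.
    rewrite expRD /E -/(Q (m s)).
    by rewrite le_eqVlt; apply/orP; left; apply/eqP; ring.
  have := lip i s _ (ltW s0) w0.
  move/(ler_wpM2l (ltW (b_pos i s)))/le_trans; apply.
  have c0 : 0 <= b i s * kappa * beta i s by rewrite !mulr_ge0 // ltW.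
  have := ler_wpM2l c0 u_le.
  by congr (_ <= _); ring.
have := lam_lt s (ltW s0); rewrite -(ltr_pM2r E0).
move: forcing; rewrite -eqN -eqNs.
have -> : sg * (dN + a s * N s - (dNs + a s * Ns s))
  = sg * (dN - dNs) + a s * (sg * (N s - Ns s)) by ring.
rewrite sgE uE.
have -> : a s * (1 - kappa * expR (lam * D)) * E
  = a s * E - kappa * expR (lam * D) * E * a s by ring.
lra.
Unshelve. all: by end_near. Qed.

Theorem theorem3p2 (R : realType) (omega : R) (n p : nat)
    (a : R -> R) (b beta tau : 'I_n -> R -> R)
    (t : nat -> R) (I : nat -> R -> R)
    (aI bI : nat -> R) (Nstar : R -> R)
    (homega : 0 < omega) (hn : (0 < n)%N) (hp : (0 < p)%N)
    (a_cont : continuous a) (a_pos : forall s, 0 < a s)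
    (a_per : forall s, a (s + omega) = a s)
    (b_cont : forall i, continuous (b i)) (b_pos : forall i s, 0 < b i s)
    (b_per : forall i s, b i (s + omega) = b i s)
    (beta_cont : forall i, continuous (beta i))
    (beta_pos : forall i s, 0 < beta i s)
    (beta_per : forall i s, beta i (s + omega) = beta i s)
    (tau_cont : forall i, continuous (tau i))
    (tau_pos : forall i s, 0 < tau i s)
    (tau_per : forall i s, tau i (s + omega) = tau i s)
    (tau_mono : forall i, {homo (fun s => s - tau i s) : x y / x <= y})
    (t_pos : 0 < t 0%N) (t_incr : forall k, t k < t k.+1)
    (t_infty : t k @[k --> \oo] --> +oo)
    (t_per : forall k, t (k + p)%N = t k + omega)
    (t_count : forall k, (t k <= omega) = (k < p)%N)
    (I_cont : forall k, {within `[0, +oo[, continuous (I k)})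
    (I_pos : forall k u, 0 < u -> 0 < u + I k u)
    (I_per : forall k u, 0 < u -> I (k + p)%N u = I k u)
    (aI_per : forall k, aI (k + p)%N = aI k)
    (bI_per : forall k, bI (k + p)%N = bI k)
    (bI_gt : forall k, (k < p)%N -> -1 < bI k)
    (I_bounds : forall k x y, (k < p)%N -> 0 <= x -> 0 <= y -> x != y ->
       bI k <= (I k x - I k y) / (x - y) <= aI k)
    (aI_prod : \prod_(k < p) (1 + aI k) <= 1)
    (Nstar_sol : is_positive_periodic_solution omega a b beta tau t I Nstar)
    (main_ineq : forall s, 0 <= s ->
       \sum_(i < n) beta i s * b i s * max_impulse_prod t bI (tau i s) s
         <= a s) :
  globally_attractive a b beta tau t I Nstar.
Proof.
move=> N [_ _ N0 solN]; have [solNs Ns_pos Ns_per] := Nstar_sol.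
have [m mP] := impulse_counter t_incr t_infty.
have t_ge0 k : 0 <= t k.
  by apply/ltW; elim: k => // k; move/lt_trans; apply.
have bI_gt' k : -1 < bI k.
  by move: k; apply: (nat_period_ind hp) => // k; rewrite bI_per.
have I_bounds' k x y : 0 < x -> 0 < y -> x != y ->
    bI k <= (I k x - I k y) / (x - y) <= aI k.
  move=> x0 y0 xy; move: k; apply: (nat_period_ind hp) => [k kp|k].
    by apply: I_bounds => //; exact: ltW.
  by rewrite !I_per // aI_per bI_per.
have bI_le_aI k : bI k <= aI k.
  have /andP[] : bI k <= (I k 2 - I k 1) / (2 - 1) <= aI k.
    by apply: I_bounds' => //; rewrite gt_eqF //; lra.
  exact: le_trans.
have half_pos (k : 'I_p) : 0 < (1 + bI k) / 2 by have := bI_gt' k; lra.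
(* Half of [1 + bI k] suffices for [jump], and is reached by comparing [u] with
   [u / 2], where [u / 2 + I k (u / 2)] is positive. *)
have [e [e0 e1 e_le]] := finite_lower_bound half_pos.
have e_le' k : e <= (1 + bI k) / 2.
  move: k; apply: (nat_period_ind hp) => [k kp|k]; last by rewrite bI_per.
  exact: e_le (Ordinal kp).
have jump k u : 0 < u -> e * u <= u + I k u.
  move=> u0; have u2 : 0 < u / 2 by lra.
  have u2u : u != u / 2 by rewrite gt_eqF //; lra.
  have /andP[+ _] := I_bounds' k u (u / 2) u0 u2 u2u.
  have -> : u - u / 2 = u / 2 by field.
  rewrite ler_pdivlMr // => lower.
  have := ler_wpM2r (ltW u0) (e_le' k); have := I_pos k _ u2; lra.
have [[alpha A] /= [alpha0 _ a_bounds]] :=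
  periodic_bounds homega a_cont a_per a_pos.
have a_le s : 0 <= s -> a s <= A by move=> /a_bounds /andP[].
have [c c0 cN] :=
  positive_lower_bound mP t_incr hn b_pos a_le e0 e1 jump solN N0.
have N_pos s : 0 <= s -> 0 < N s.
  by move=> /cN; apply: lt_trans; rewrite !mulr_gt0 ?exprn_gt0 ?expR_gt0.
have [c' c'0 cNs] := positive_lower_bound mP t_incr hn b_pos a_le e0 e1 jump
  solNs (Ns_pos 0 (lexx 0)).
pose Nmin := c' * e ^+ p * expR (- (A * omega)).
have Nmin0 : 0 < Nmin by rewrite !mulr_gt0 ?exprn_gt0 ?expR_gt0.
have Nmin_le s : 0 <= s -> Nmin <= Nstar s.
  move=> s0.
  have [r /andP[r0 rw] ->] := periodic_reduction homega Ns_per s0.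
  apply: le_trans (ltW (cNs r r0)).
  have A0 : 0 <= A by apply: le_trans (a_le 0 (lexx 0)); exact: ltW.
  have mr : (m r <= p)%N.
    by rewrite leqNgt -mP -leNgt (le_trans rw)// ltW// ltNge t_count ltnn.
  rewrite /Nmin; apply: ler_pM; rewrite ?expR_ge0 //.
  - by rewrite mulr_ge0 ?exprn_ge0 // ltW.
  - by rewrite ler_pM2l // ler_wiXn2l // ltW.
  - by rewrite ler_expR lerN2 ler_wpM2l.
have [beta_b beta_bP] := choice (fun i =>
  periodic_bounds homega (beta_cont i) (beta_per i) (beta_pos i)).
have [tau_b tau_bP] := choice (fun i =>
  periodic_bounds homega (tau_cont i) (tau_per i) (tau_pos i)).
have beta_b0 i : 0 < (beta_b i).1 by have [] := beta_bP i.
have [beta0 [beta0_gt0 _ beta0_le]] := finite_lower_bound beta_b0.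
pose D := 1 + \sum_i (tau_b i).2.
have tau_b0 i : 0 <= (tau_b i).2 by have [_ /ltW] := tau_bP i.
have D0 : 0 < D by rewrite ltr_wpDr // sumr_ge0.
have tau_le i s : 0 <= s -> tau i s <= D.
  move=> s0; have [_ _ /(_ s s0)/andP[_ h]] := tau_bP i.
  rewrite (le_trans h) // /D (bigD1 i) //= addrCA lerDl addr_ge0 // sumr_ge0 //.
(* A lower bound for all the exponents [beta i s * Nstar w], which makes the
   contraction factor independent of time. *)
pose q := beta0 * Nmin.
have q0 : 0 < q by rewrite mulr_gt0.
pose kappa := (1 + expR (- (q / 2))) / 2.
have kappa0 : 0 <= kappa by rewrite divr_ge0 // addr_ge0 // expR_ge0.
have kappa1 : kappa < 1.
  have : expR (- (q / 2)) < 1 by rewrite -[ltRHS]expR0 ltr_expR; lra.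
  rewrite /kappa; lra.
have [lam lam0 lam_lt] := decay_rate D alpha0 kappa1.
have lam_lt' s : 0 <= s -> lam < a s * (1 - kappa * expR (lam * D)).
  move=> s0; apply: (lt_le_trans lam_lt); apply: ler_wpM2r.
    by rewrite -(pmulr_rge0 _ alpha0); exact: ltW (lt_trans lam0 lam_lt).
  by have /andP[] := a_bounds s s0.
have lip i s w : 0 <= s -> 0 <= w ->
    `|expR (- (beta i s * N w)) - expR (- (beta i s * Nstar w))|
      <= kappa * (beta i s * `|N w - Nstar w|).
  move=> s0 w0; have beta_ge0 := ltW (beta_pos i s).
  have -> : beta i s * `|N w - Nstar w|
      = `|beta i s * N w - beta i s * Nstar w|.
    by rewrite -mulrBr normrM ger0_norm.
  apply: expR_contraction.
  - by rewrite mulr_ge0 // ltW // N_pos.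
  - by rewrite mulr_ge0 // ltW // Ns_pos.
  - apply: ler_pM; rewrite ?(ltW beta0_gt0) ?(ltW Nmin0) ?Nmin_le //.
    have [_ _ /(_ s s0)/andP[h _]] := beta_bP i.
    exact: le_trans (beta0_le i) h.
(* When the two solutions agree at [t k], any ratio between [1 + bI k] and
   [1 + aI k] describes the jump of their difference. *)
pose r k := if N (t k) == Nstar (t k) then 1 + bI k
  else 1 + (I k (N (t k)) - I k (Nstar (t k))) / (N (t k) - Nstar (t k)).
have r_bounds k : 1 + bI k <= r k <= 1 + aI k.
  rewrite /r; case: ifPn => [_|neq]; first by rewrite lexx lerD2l bI_le_aI.
  by rewrite !lerD2l; apply: I_bounds' => //; [exact: N_pos|exact: Ns_pos].
have r_ge k : 1 + bI k <= r k by have /andP[] := r_bounds k.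
have rE k : N (t k) + I k (N (t k)) - (Nstar (t k) + I k (Nstar (t k)))
    = r k * (N (t k) - Nstar (t k)).
  rewrite /r; case: ifPn => [/eqP ->|neq]; first by rewrite !subrr mulr0.
  by field; rewrite subr_eq0.
have [K hK] := difference_quotient_decay mP t_incr b_pos beta_pos tau_pos D0
  tau_le bI_gt' r_ge rE solN solNs kappa0 lip main_ineq lam0 lam_lt'.
have aI0 k : 0 < 1 + aI k by have := bI_gt' k; have := bI_le_aI k; lra.
have [C C0 hC] : exists2 C, 0 < C & forall j, \prod_(k < j) (1 + aI k) <= C.
  by apply: periodic_prod_bounded hp _ aI0 aI_prod => k; rewrite aI_per.
have r0 k : 0 < r k by apply: lt_le_trans (r_ge k); have := bI_gt' k; lra.
have bound s : D <= s ->
    - (K * C * expR (- (lam * s))) <= N s - Nstar s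
      <= K * C * expR (- (lam * s)).
  move=> Ds; rewrite -ler_norml; apply: le_trans (ltW (hK s Ds)) _.
  have Q0 : 0 < \prod_(k < m s) r k by apply: prodr_gt0.
  have K0 : 0 <= K.
    have := le_lt_trans (normr_ge0 _) (hK s Ds).
    by rewrite pmulr_lgt0 // pmulr_lgt0 ?expR_gt0 //; exact: ltW.
  rewrite mulrAC ler_wpM2r ?expR_ge0 // ler_wpM2l //.
  apply: le_trans (hC (m s)); apply: ler_prod => k _.
  by have /andP[_ ->] := r_bounds k; rewrite ltW.
have decay : K * C * expR (- (lam * s)) @[s --> +oo] --> (0 : R).
  rewrite -(mulr0 (K * C)); apply: cvgM; first exact: cvg_cst.
  apply: (@cvg_comp _ _ _ (fun s => lam * s) (fun z => expR (- z)) _ +oo);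
    last exact: cvgr_expR.
  apply/cvgryPge => B.
  apply: filterS (nbhs_pinfty_ge (num_real (B / lam))) => s.
  by rewrite ler_pdivrMr // mulrC.
have decayN : - (K * C * expR (- (lam * s))) @[s --> +oo] --> (0 : R).
  by rewrite -oppr0; exact: cvgN decay.
apply: (squeeze_cvgr _ decayN decay).
by apply: filterS bound _; exact: nbhs_pinfty_ge (num_real _).
Qed.
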